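(* Suppose that Assumptions 1 and 4 (stated in the context) hold. Then, for any $x\in\mathbb{R}^d$, $c\in\mathbb{R}$, $\mu>0$ and $m\in\mathbb{N}$ ($m\ge1$), $$\mathbb{E}_{u\sim\mathcal N(0,I_d)}\left[\mathbb{E}_{\{\xi^j\}_{j=1}^m\sim D(x+\mu u)}\left[\left\|\frac1m\sum_{j=1}^m g_1(x,\mu,c,u,\xi^j)\right\|^2\right]\right]\le\frac32\mu^2H_F^2(d+6)^3+6(d+4)\|\nabla F(x)\|^2+\frac{3\sigma^2d}{\mu^2m}+\frac{3d(F(x)-c)^2}{\mu^2},$$ where, given $u$, $\xi^1,\dots,\xi^m$ are i.i.d. samples from $D(x+\mu u)$.
   Context: For each $x\in\mathbb{R}^d$, $D(x)$ is a probability distribution of a random vector $\xi$ in a Euclidean space, $f(x,\xi)$ is real valued, and $F(x):=\mathbb{E}_{\xi\sim D(x)}[f(x,\xi)]$. $\|\cdot\|$ is the Euclidean norm and $\mathcal N(0,I_d)$ the standard normal distribution on $\mathbb{R}^d$. Assumption 1: there is a constant $\sigma\ge 0$ such that $\mathbb{E}_{\xi\sim D(x)}[(F(x)-f(x,\xi))^2]\le\sigma^2$ for all $x\in\mathbb{R}^d$. Assumption 4: $F$ is $H_F$-smooth, i.e. differentiable with $H_F$-Lipschitz gradient. One-point gradient estimator: $g_1(x,\mu,c,u,\xi):=\frac{f(x+\mu u,\xi)-c}{\mu}u$. *)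

(* Defs.v *)
From HB Require Import structures.
From mathcomp Require Import all_boot all_order all_algebra.
From mathcomp Require Import all_classical all_reals all_analysis.

Set Implicit Arguments.
Unset Strict Implicit.
Unset Printing Implicit Defensive.

Import Order.TTheory GRing.Theory Num.Theory.
Import numFieldNormedType.Exports.

Local Open Scope classical_set_scope.
Local Open Scope ring_scope.

Section iid.
Context d (T : measurableType d) (R : realType).

Definition cons_pair n (p : T * n.-tuple T) : n.+1.-tuple T :=
  [the n.+1.-tuple T of p.1 :: p.2].

Lemma measurable_cons_pair n : measurable_fun setT (@cons_pair n).
Proof. exact: measurable_cons. Qed.

HB.instance Definition _ n :=
  isMeasurableFun.Build _ _ _ _ (@cons_pair n) (@measurable_cons_pair n).

(* The n-fold product measure P x ... x P, i.e. the law of n i.i.d. draws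
   from P, on the product sigma-algebra of n.-tuple T. *)
Fixpoint iid_prob (P : probability T R) n : probability (n.-tuple T) R :=
  match n with
  | 0 => @dirac _ _ [tuple] R
  | n'.+1 => distribution (P \x iid_prob P n')%E (@cons_pair n')
  end.

Lemma iid_prob_box (P : probability T R) n (A : 'I_n -> set T) :
  (forall i, measurable (A i)) ->
  iid_prob P n [set t | forall i, A i (tnth t i)] = (\prod_(i < n) P (A i))%E.
Proof.
elim: n A => [|n IH] A mA /=.
  rewrite big_ord0 diracE mem_set//= => -[//].
have mB : measurable [set t : n.-tuple T | forall i, A (lift ord0 i) (tnth t i)].
  rewrite (_ : mkset _ = \bigcap_(i in [set: 'I_n])
     ((fun t : n.-tuple T => tnth t i) @^-1` A (lift ord0 i))); last first.
    by apply/seteqP; split=> t /= h i => [_|]; exact: h.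
  apply: fin_bigcap_measurable => [|i _]; first exact: finite_finset.
  rewrite -[X in measurable X]setTI.
  exact: (measurable_tnth i).
rewrite /distribution /pushforward.
rewrite (_ : _ @^-1` _ = A ord0 `*`
    [set t : n.-tuple T | forall i, A (lift ord0 i) (tnth t i)]); last first.
  apply/seteqP; split=> -[x t] /=.
    move=> h; split; first by move: (h ord0); rewrite tnth0.
    by move=> i; move: (h (lift ord0 i)); rewrite tnthS.
  move=> [h0 h] i; case: (unliftP ord0 i) => [j ->|->].
    by rewrite tnthS; exact: h.
  by rewrite tnth0.
by rewrite big_ord_recl product_measure1E//=; congr (_ * _)%E; exact: IH.
Qed.

End iid.

Section euclidean.
Context {R : realType} {d : nat}.
Implicit Types (x y : 'rV[R]_d) (F : 'rV[R]_d -> R).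

(* The library norm on 'rV[R]_d is the sup norm. *)
Definition enorm x : R := Num.sqrt (\sum_(i < d) x 0 i ^+ 2).

Definition gradient F x : 'rV[R]_d := \row_(i < d) 'D_(delta_mx 0 i) F x.

(* [differentiable] refers to the sup norm, which is equivalent to the
   Euclidean norm. *)
Definition smooth (H : R) F : Prop :=
  (forall x, differentiable F x) /\
  (forall x y, enorm (gradient F x - gradient F y) <= H * enorm (x - y)).

(* R^d with its product (= Borel) sigma-algebra is d.-tuple R, while the
   topology and differential structure live on 'rV[R]_d. *)
Definition row_of_tuple (u : d.-tuple R) : 'rV[R]_d := \row_(i < d) tnth u i.

End euclidean.

Section gaussian.
Context (R : realType).

(* The library's N(0, 1), retyped from the sigma-algebra display of
   measurableTypeR R to the default one of R (same measurable sets). *)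
Definition std_normal : set R -> \bar R := normal_prob (0 : R) 1.

Let std_normal0 : std_normal set0 = 0%E.
Proof. exact: (measure0 (normal_prob (0 : R) 1)). Qed.

Let std_normal_ge0 A : (0 <= std_normal A)%E.
Proof. exact: (measure_ge0 (normal_prob (0 : R) 1)). Qed.

Let std_normal_sigma_additive : semi_sigma_additive std_normal.
Proof. exact: (@measure_semi_sigma_additive _ _ _ (normal_prob (0 : R) 1)). Qed.

HB.instance Definition _ := isMeasure.Build _ _ _ std_normal
  std_normal0 std_normal_ge0 std_normal_sigma_additive.

Let std_normal_setT : std_normal setT = 1%E.
Proof. exact: (probability_setT (normal_prob (0 : R) 1)). Qed.

HB.instance Definition _ :=
  Measure_isProbability.Build _ _ _ std_normal std_normal_setT.

(* N(0, I_d): the coordinates are i.i.d. N(0, 1). *)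
Definition std_gaussian (d : nat) : probability (d.-tuple R) R :=
  iid_prob std_normal d.

End gaussian.

Section estimator.
Context {R : realType} {d k : nat}.
Variables (D : 'rV[R]_d -> probability (k.-tuple R) R).
Variables (f : 'rV[R]_d -> k.-tuple R -> R).

(* [fine] loses nothing: for measurable [f x], a finite second moment of
   [objective x - f x xi] (see [bounded_variance]) makes [f x] integrable. *)
Definition objective (x : 'rV[R]_d) : R := fine 'E_(D x)[f x].

Definition bounded_variance (sigma : R) : Prop :=
  forall x, ('E_(D x)[fun xi => ((objective x - f x xi) ^+ 2)%R]
             <= (sigma ^+ 2)%:E)%E.

Definition one_point_estimator (x : 'rV[R]_d) (mu c : R) (u : 'rV[R]_d)
    (xi : k.-tuple R) : 'rV[R]_d :=
  ((f (x + mu *: u) xi - c) / mu) *: u.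

End estimator.

(* Main.v *)
Require Import Defs.
From mathcomp Require Import all_boot all_order all_algebra.
From mathcomp Require Import all_classical all_reals all_analysis.
From mathcomp Require Import measurable_realfun normal_distribution ring lra.
Import Order.TTheory GRing.Theory Num.Theory.
Import numFieldNormedType.Exports.
Set Implicit Arguments.
Unset Strict Implicit.
Unset Printing Implicit Defensive.

(* Put y = x + mu u and let F be the objective.  Given u, the estimator is a
   scalar multiple of u, and the bias-variance decomposition bounds its second
   moment by |u|^2 / mu^2 * (sigma^2 / m + (F y - c)^2).  Write
   F y - c = (F y - F x - mu <grad F x, u>) + mu <grad F x, u> + (F x - c), use
   (a + b + c)^2 <= 3 (a^2 + b^2 + c^2) and bound the first term by
   H / 2 * mu^2 |u|^2.  It remains to integrate |u|^2, <g, u>^2 |u|^2 and |u|^6,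
   whose Gaussian expectations are d, (d + 2) |g|^2 and d (d + 2) (d + 4). *)

Local Open Scope classical_set_scope.
Local Open Scope ring_scope.

(** * Inequalities between integrals of nonnegative functions *)

(* Needed because [f] and [D] need not depend measurably on the base point, so the
   outer integrand of the theorem need not be measurable. *)
Lemma le_nonmeasurable_integralT d (T : measurableType d) (R : realType)
    (mu : {measure set T -> \bar R}) (f g : T -> \bar R) :
  (forall x, 0 <= f x)%E -> (forall x, f x <= g x)%E ->
  (\int[mu]_x f x <= \int[mu]_x g x)%E.
Proof.
move=> f0 fg; have g0 x : (0 <= g x)%E by exact: le_trans (fg x).
rewrite !ge0_integralTE//; apply: le_ereal_sup => _ [h hf <-].
by exists h => // x; exact: le_trans (fg x).
Qed.

Lemma ge0_integralDZ_le d (T : measurableType d) (R : realType)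
    (mu : {measure set T -> \bar R}) (f g : T -> R) (c a b : R) :
  measurable_fun setT f -> measurable_fun setT g ->
  (forall x, 0 <= f x) -> (forall x, 0 <= g x) -> 0 <= c ->
  (\int[mu]_x (f x)%:E <= a%:E)%E -> (\int[mu]_x (g x)%:E <= b%:E)%E ->
  (\int[mu]_x (f x + c * g x)%:E <= (a + c * b)%:E)%E.
Proof.
move=> mf mg f0 g0 c0 fa gb.
under eq_integral do rewrite EFinD EFinM.
have mEf : measurable_fun setT (EFin \o f : T -> _) by exact/measurable_EFinP.
have mEg : measurable_fun setT (EFin \o g : T -> _) by exact/measurable_EFinP.
rewrite ge0_integralD//=; last 3 first.
- by move=> x _; rewrite lee_fin.
- by move=> x _; rewrite -EFinM lee_fin mulr_ge0.
- exact: measurable_funeM.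
rewrite ge0_integralZl//; last by move=> x _; rewrite lee_fin.
by rewrite EFinD EFinM leeD// lee_wpmul2l// lee_fin.
Qed.

(** A constant plus three nonnegative terms is the shape of the polynomial integrands met below;
    shorter ones take zero coefficients. *)
Lemma ge0_integral_affine_le d (T : measurableType d) (R : realType)
    (P : probability T R) (f1 f2 f3 : T -> R) (c0 c1 c2 c3 a1 a2 a3 : R) :
  measurable_fun setT f1 -> measurable_fun setT f2 -> measurable_fun setT f3 ->
  (forall x, 0 <= f1 x) -> (forall x, 0 <= f2 x) -> (forall x, 0 <= f3 x) ->
  0 <= c0 -> 0 <= c1 -> 0 <= c2 -> 0 <= c3 ->
  (\int[P]_x (f1 x)%:E <= a1%:E)%E ->
  (\int[P]_x (f2 x)%:E <= a2%:E)%E ->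
  (\int[P]_x (f3 x)%:E <= a3%:E)%E ->
  (\int[P]_x (c0 + c1 * f1 x + c2 * f2 x + c3 * f3 x)%:E
    <= (c0 + c1 * a1 + c2 * a2 + c3 * a3)%:E)%E.
Proof.
move=> m1 m2 m3 p1 p2 p3 h0 h1 h2 h3 i1 i2 i3.
have mZ c (h : T -> R) : measurable_fun setT h ->
    measurable_fun setT (fun x => c * h x) by move=> mh; exact: measurable_funM.
have mD1 : measurable_fun setT (fun x => c0 + c1 * f1 x).
  by apply: measurable_funD => //; exact: mZ.
have mD2 : measurable_fun setT (fun x => c0 + c1 * f1 x + c2 * f2 x).
  by apply: measurable_funD => //; exact: mZ.
apply: ge0_integralDZ_le => //.
  by move=> x; rewrite !addr_ge0 ?mulr_ge0.
apply: ge0_integralDZ_le => //.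
  by move=> x; rewrite addr_ge0 ?mulr_ge0.
apply: ge0_integralDZ_le => //.
by rewrite integral_cst//= [P setT]probability_setT mule1.
Qed.

(** * Even moments of the one-dimensional standard normal law *)

Section std_normal_moments.
Context {R : realType}.
Local Notation mu := (@lebesgue_measure R).
Local Notation phi := (normal_pdf (0 : R) 1).

(** The Radon-Nikodym derivative of the normal law and [phi] have the same integral over every
    measurable set, so they agree almost everywhere. *)
Lemma integral_std_normal (f : R -> \bar R) :
  measurable_fun setT f -> (forall x, 0 <= f x)%E ->
  (\int[@std_normal R]_x f x = \int[mu]_x (f x * (phi x)%:E))%E.
Proof.
move=> mf f0.
have dom := @normal_prob_dominates R 0 1.
(* [idfun] only changes the sigma-algebra display. *)
have mid : measurable_fun setT (idfun : measurableTypeR R -> R).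
  by move=> _ A mA; rewrite setTI.
have -> : (\int[@std_normal R]_x f x = \int[normal_prob (0 : R) 1]_x f x)%E.
  rewrite (eq_measure_integral (pushforward (normal_prob (0 : R) 1)
    (idfun : measurableTypeR R -> R)))//.
  by rewrite (ge0_integral_pushforward mid).
rewrite -(Radon_Nikodym_SigmaFinite.change_of_variables dom)//=.
have mphi : measurable_fun [set: R] (fun x => (phi x)%:E).
  by apply/measurable_EFinP; exact: measurable_normal_pdf.
have iRN := Radon_Nikodym_SigmaFinite.f_integrable dom.
apply: ae_eq_integral => //.
- by apply: emeasurable_funM => //; exact: measurable_int iRN.
- exact: emeasurable_funM.
- apply: ae_eqe_mul2l; apply: integral_ae_eq => //.
  by move=> A _ mA; rewrite -Radon_Nikodym_SigmaFinite.f_integral.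
Qed.

Lemma std_normal_pdfN x : phi (- x) = phi x.
Proof.
by rewrite normal_pdfE ?oner_eq0// /normal_fun !subr0 sqrrN.
Qed.

(** Both the density [phi] and Lebesgue measure are invariant under reflection. *)
Lemma integral_std_normalN (f : R -> \bar R) :
  measurable_fun setT f -> (forall x, 0 <= f x)%E ->
  (\int[@std_normal R]_x f (- x)%R = \int[@std_normal R]_x f x)%E.
Proof.
move=> mf f0.
have mphi : measurable_fun [set: R] (fun x => (phi x)%:E).
  by apply/measurable_EFinP; exact: measurable_normal_pdf.
rewrite !integral_std_normal//; last exact: measurableT_comp.
have mN : measurable_fun setT (-%R : measurableTypeR R -> measurableTypeR R).
  exact: oppr_measurable.
transitivity (\int[pushforward mu (-%R : measurableTypeR R -> measurableTypeR R)]_x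
    (f x * (phi x)%:E))%E.
  rewrite (ge0_integral_pushforward mN).
  - by rewrite preimage_setT; apply: eq_integral => x _; rewrite /= std_normal_pdfN.
  - exact: measurableT.
  - exact: emeasurable_funM.
  - by move=> x _; rewrite mule_ge0// lee_fin normal_pdf_ge0.
by apply: eq_measure_integral => //= A mA _; exact: lebesgue_measureN.
Qed.

Lemma is_derive_std_normal_pdf (x : R) : is_derive x 1 phi (- (x * phi x)).
Proof.
rewrite normal_pdfE ?oner_eq0//.
rewrite (_ : (fun x0 : R => normal_peak 1 * normal_fun 0 1 x0) =
   (normal_peak 1 \*: (fun x => expR (- (x ^+ 2 / 2))))); last first.
  by apply/funext => y; rewrite /normal_fun subr0 expr1n mulNr.
apply: is_derive_eq.
rewrite /normal_fun subr0 expr1n mulNr /GRing.scale /=. by field.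
Qed.


(* Only an upper bound: integrating by parts on [0, n] leaves the nonpositive
   boundary term - n ^ (k+1) phi(n), which is dropped before n tends to infinity. *)
Lemma std_normal_moment_rec k : ~~ odd k ->
  (\int[@std_normal R]_x (x ^+ k.+2)%:E <=
   k.+1%:R%:E * \int[@std_normal R]_x (x ^+ k)%:E)%E.
Proof.
move=> ek.
have cX n : continuous (fun x : R => x ^+ n) by exact: exprn_continuous.
have cphi : continuous phi by apply: continuous_normal_pdf; rewrite oner_eq0.
have cXphi n : continuous (fun x : R => x ^+ n * phi x).
  by move=> x; apply: cvgM; [exact: cX|exact: cphi].
have X_ge0 n (x : R) : ~~ odd n -> 0 <= x ^+ n by move=> en; rewrite exprn_even_ge0.
have Xphi_ge0 n (x : R) : ~~ odd n -> 0 <= x ^+ n * phi x.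
  by move=> en; rewrite mulr_ge0 ?X_ge0// normal_pdf_ge0.
have mX n : measurable_fun [set: R] (fun x => (x ^+ n)%:E).
  by apply/measurable_EFinP; exact: measurable_funX.
have half n : ~~ odd n -> (\int[@std_normal R]_x (x ^+ n)%:E =
    2%:E * \int[mu]_(x in `[0%R, +oo[) (x ^+ n * phi x)%:E)%E.
  move=> en; rewrite integral_std_normal//; last first.
    by move=> x; rewrite lee_fin X_ge0.
  under eq_integral do rewrite -EFinM.
  rewrite (ge0_symfun_integralT (fun x => Xphi_ge0 n x en) (cXphi n)).
    by rewrite set_itvcy.
  by move=> x /=; rewrite std_normal_pdfN exprNn -signr_odd (negbTE en) mul1r.
have ek2 : ~~ odd k.+2 by rewrite /= negbK.
(* The half-line integral is the supremum of the integrals over [[0, n.+1]], so each of these is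
   bounded separately; the successor keeps the interval nondegenerate. *)
rewrite !half// muleCA lee_wpmul2l// ge0_integral_ereal_sup//=; last 2 first.
- by move=> x; exact: Xphi_ge0.
- exact: continuous_measurable_fun.
apply: ge_ereal_sup => _ [n _ <-].
have wc (f : R -> R) : continuous f -> {within `[0, n.+1%:R], continuous f}.
  by move=> cf; exact: continuous_subspaceT.
have dX (x : R) : is_derive x 1 (fun y : R => y ^+ k.+1) (k.+1%:R * x ^+ k).
  apply: DeriveDef; first exact: exprn_derivable.
  by rewrite exp_derive /GRing.scale/= mulr1.
have dphi (x : R) : is_derive x 1 (fun y => - phi y) (x * phi x).
  have := is_derive_std_normal_pdf x => ?.
  by apply: is_derive_eq; rewrite opprK.
have LR (F : R -> R) (F' : R -> R) : (forall x : R, is_derive x 1 F (F' x)) ->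
    derivable_oo_LRcontinuous F 0 n.+1%:R.
  move=> dF; have cF : continuous F.
    by move=> x; apply: differentiable_continuous; apply/derivable1_diffP.
  split=> [x _| |]; first by [].
  - by apply: cvg_at_right_filter; exact: cF.
  - by apply: cvg_at_left_filter; exact: cF.
(* Split [x ^ (k+2) phi] as [x ^ (k+1)] times [x phi], whose primitive is [- phi]. The boundary term
   at 0 vanishes because the exponent [k+1] is positive. *)
have := @integration_by_parts R (fun y : R => y ^+ k.+1) (fun y => - phi y)
  (fun x => k.+1%:R * x ^+ k) (fun x => x * phi x) 0 n.+1%:R.
move=> /(_ (ltr0Sn _ _)); rewrite !expr0n/= mul0r subr0 => parts.
under eq_integral do rewrite exprSr -mulrA.
rewrite parts; first last.
- by move=> x _; rewrite derive1E; have [_ ->] := dphi x.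
- exact: LR dphi.
- by apply: wc => x; apply: cvgM; [exact: cvg_id|exact: cphi].
- by move=> x _; rewrite derive1E; have [_ ->] := dX x.
- exact: LR dX.
- by apply: wc => x; apply: cvgM; [exact: cvg_cst|exact: cX].
under eq_integral do rewrite mulrN -mulrA EFinN.
rewrite integral_ge0N/=; last first.
  by move=> x _; rewrite lee_fin mulr_ge0// Xphi_ge0.
rewrite oppeK; under eq_integral do rewrite EFinM.
have mXphi (A : set R) : measurable_fun A (fun x => (x ^+ k * phi x)%:E).
  by apply/measurable_funTS/measurable_EFinP; exact: continuous_measurable_fun.
rewrite ge0_integralZl//=; last 2 first.
- exact: mXphi.
- by move=> x _; rewrite lee_fin Xphi_ge0.
rewrite -[leRHS]add0e; apply: leeD.
  by rewrite lee_fin mulrN oppr_le0 mulr_ge0 ?exprn_ge0 ?normal_pdf_ge0.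
apply: lee_wpmul2l; first by rewrite lee_fin.
apply: ge0_subset_integral => //=.
- exact: mXphi.
- by move=> x _; rewrite lee_fin Xphi_ge0.
- exact: subset_itvl.
Qed.

Lemma std_normal_moment2 : (\int[@std_normal R]_x (x ^+ 2)%:E <= 1)%E.
Proof.
apply: (le_trans (@std_normal_moment_rec 0 isT)).
under eq_integral do rewrite expr0.
by rewrite mul1e integral_cst//= [X in (1 * X)%E]probability_setT mule1.
Qed.

Lemma std_normal_moment4 : (\int[@std_normal R]_x (x ^+ 4)%:E <= 3%:E)%E.
Proof.
apply: (le_trans (@std_normal_moment_rec 2 isT)).
rewrite -[leRHS]mule1; apply: lee_wpmul2l; first by rewrite lee_fin.
exact: std_normal_moment2.
Qed.

Lemma std_normal_moment6 : (\int[@std_normal R]_x (x ^+ 6)%:E <= 15%:E)%E.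
Proof.
apply: (le_trans (@std_normal_moment_rec 4 isT)).
rewrite (_ : 15%:E = 5%:E * 3%:E)%E; last by rewrite -EFinM; congr EFin; ring.
apply: lee_wpmul2l; first by rewrite lee_fin.
exact: std_normal_moment4.
Qed.

(** The weights 1, 3 and 15 are the bounds on the second, fourth and sixth moments. Giving [p]
    through an equation lets [ring] recognise the coefficients. *)
Lemma integral_std_normal_even6_le (p : R -> R) (c0 c1 c2 c3 b : R) :
  0 <= c0 -> 0 <= c1 -> 0 <= c2 -> 0 <= c3 ->
  (forall x, p x = c0 + c1 * x ^+ 2 + c2 * x ^+ 4 + c3 * x ^+ 6) ->
  c0 + c1 + 3 * c2 + 15 * c3 <= b ->
  (\int[@std_normal R]_x (p x)%:E <= b%:E)%E.
Proof.
move=> c00 c10 c20 c30 pE cb; under eq_integral do rewrite pE.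
apply: le_trans.
  apply: (@ge0_integral_affine_le _ _ _ (@std_normal R) (fun x => x ^+ 2)
    (fun x => x ^+ 4) (fun x => x ^+ 6) _ _ _ _ 1 3 15) => //;
    try by move=> x; rewrite exprn_even_ge0.
  - exact: std_normal_moment2.
  - exact: std_normal_moment4.
  - exact: std_normal_moment6.
by rewrite lee_fin; lra.
Qed.

End std_normal_moments.

(** * Integration against the law of i.i.d. draws *)

Section iid_integral.
Context d (T : measurableType d) (R : realType) (P : probability T R).
Local Open Scope ereal_scope.

Lemma ge0_integral_iid0 (h : 0.-tuple T -> \bar R) :
  measurable_fun setT h -> \int[iid_prob P 0]_t h t = h [tuple].
Proof. by move=> mh; rewrite /= integral_dirac// diracT mul1e. Qed.

Section succ.
Context n (h : n.+1.-tuple T -> \bar R).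
Hypotheses (mh : measurable_fun setT h) (h0 : forall t, 0 <= h t).

Let mhcons : measurable_fun setT (h \o @cons_pair _ T n).
Proof. by apply: measurableT_comp => //; exact: measurable_cons_pair. Qed.

(** Tonelli with the new coordinate outermost: an induction hypothesis can then be applied to the
    inner integral with a parameter depending on [x]. *)
Lemma ge0_integral_iidS1 :
  \int[iid_prob P n.+1]_t h t =
  \int[P]_x \int[iid_prob P n]_t h (cons_pair (x, t)).
Proof.
rewrite /= ge0_integral_distribution//.
by rewrite (fubini_tonelli1 (h \o @cons_pair _ T n) mhcons)// => p; exact: h0.
Qed.

(** The opposite order: the inner integral is one-dimensional, so that a moment computation in the
    new coordinate applies to it. *)
Lemma ge0_integral_iidS2 :
  \int[iid_prob P n.+1]_t h t =
  \int[iid_prob P n]_t \int[P]_x h (cons_pair (x, t)).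
Proof.
rewrite /= ge0_integral_distribution//.
by rewrite (fubini_tonelli2 (h \o @cons_pair _ T n) mhcons)// => p; exact: h0.
Qed.

End succ.
End iid_integral.

Lemma measurable_sum_tnth d (T : measurableType d) (R : realType) n
    (F : 'I_n -> T -> R) :
  (forall i, measurable_fun setT (F i)) ->
  measurable_fun [set: n.-tuple T] (fun t => \sum_(i < n) F i (tnth t i)).
Proof.
move=> mF; apply: measurable_sum => i.
by apply: (measurableT_comp (mF i)); exact: measurable_tnth.
Qed.

Lemma sum_tnth_cons d (T : measurableType d) (R : realType) n
    (F : 'I_n.+1 -> T -> R) (p : T * n.-tuple T) :
  \sum_(i < n.+1) F i (tnth (cons_pair p) i) =
  F ord0 p.1 + \sum_(i < n) F (lift ord0 i) (tnth p.2 i).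
Proof.
rewrite big_ord_recl/= tnth0; congr (_ + _).
by apply: eq_bigr => i _; rewrite tnthS.
Qed.

Lemma integrable_sqr d (T : measurableType d) (R : realType)
    (P : {measure set T -> \bar R}) (h : T -> R) (v : R) :
  measurable_fun setT h -> (\int[P]_x (h x ^+ 2)%:E <= v%:E)%E ->
  P.-integrable setT (fun x => (h x ^+ 2)%:E).
Proof.
move=> mh hv; apply/integrableP; split.
  by apply/measurable_EFinP; exact: measurable_funX.
under eq_integral do rewrite gee0_abs ?lee_fin ?sqr_ge0//.
by apply: le_lt_trans hv _; rewrite ltry.
Qed.

(** * Second moment of a shifted sum of centered i.i.d. variables *)

Section iid_second_moment.
Context d (T : measurableType d) (R : realType) (P : probability T R).
Variables (g : T -> R) (v : R).
Hypothesis mg : measurable_fun setT g.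
Hypothesis intg : P.-integrable setT (EFin \o g).
Hypothesis Eg : (\int[P]_x (g x)%:E = 0)%E.
Hypothesis Eg2 : (\int[P]_x (g x ^+ 2)%:E <= v%:E)%E.

(** Expanding the square, the cross term [2 a g] integrates to 0 because [g] is centered. *)
Lemma integral_sqrD_le a : (\int[P]_x ((g x + a) ^+ 2)%:E <= (v + a ^+ 2)%:E)%E.
Proof.
have ig2 := integrable_sqr mg Eg2.
have -> : (\int[P]_x ((g x + a) ^+ 2)%:E =
    \int[P]_x ((g x ^+ 2)%:E + ((2 * a)%:E * (g x)%:E + (a ^+ 2)%:E)))%E.
  by apply: eq_integral => x _; rewrite -EFinM -!EFinD; congr EFin; ring.
have iag : P.-integrable setT (fun x => (2 * a)%:E * (g x)%:E)%E by exact: integrableZl.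
have ia : P.-integrable setT (fun=> (a ^+ 2)%:E) by exact: finite_measure_integrable_cst.
rewrite integralD//=; last exact: integrableD.
rewrite integralD//= integralZl//= Eg mule0 add0e integral_cst//=.
by rewrite [P setT]probability_setT mule1 EFinD leeD2r.
Qed.

(** Induction on [n] for all shifts at once: the first draw is absorbed into the shift, which
    becomes [g x + a], and [integral_sqrD_le] then integrates over that draw. Covariances never have
    to be treated separately. *)
Lemma iid_integral_sqr_sumD_le n a :
  (\int[iid_prob P n]_t ((\sum_(i < n) g (tnth t i) + a) ^+ 2)%:E
    <= (n%:R * v + a ^+ 2)%:E)%E.
Proof.
have mS k b : measurable_fun [set: k.-tuple T]
    (fun t => ((\sum_(i < k) g (tnth t i) + b) ^+ 2)%:E).
  apply/measurable_EFinP; apply: measurable_funX; apply: measurable_funD => //.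
  exact: (@measurable_sum_tnth _ _ _ _ (fun=> g)).
elim: n a => [|n IH] a.
  by rewrite ge0_integral_iid0// big_ord0 add0r mul0r add0r.
rewrite ge0_integral_iidS1//; last by move=> t; rewrite lee_fin sqr_ge0.
under eq_integral => x _.
  under eq_integral => t _.
    rewrite (sum_tnth_cons (fun=> g))/= addrAC addrC.
    over.
  over.
apply: le_trans.
  apply: (@le_nonmeasurable_integralT _ _ _ _ _
    (fun x => ((n%:R * v)%:E + ((g x + a) ^+ 2)%:E)%E)).
    by move=> x; apply: integral_ge0 => t _; rewrite lee_fin sqr_ge0.
  by move=> x; rewrite -EFinD; exact: IH.
have v0 : 0 <= v.
  rewrite -lee_fin; apply: le_trans Eg2; apply: integral_ge0 => x _.
  by rewrite lee_fin sqr_ge0.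
rewrite ge0_integralD//=; last 3 first.
- by move=> x _; rewrite lee_fin mulr_ge0.
- by move=> x _; rewrite lee_fin sqr_ge0.
- by apply/measurable_EFinP; apply: measurable_funX; exact: measurable_funD.
rewrite integral_cst//= [P setT]probability_setT mule1.
apply: (@le_trans _ _ ((n%:R * v)%:E + (v + a ^+ 2)%:E)%E).
  by rewrite leeD2l// integral_sqrD_le.
by rewrite -EFinD lee_fin -natr1; nra.
Qed.

End iid_second_moment.

(** Averaging [p] with its reflection replaces it by its even part [q]. Odd cross terms thus
    disappear without being integrated on their own, and only nonnegative functions are split. *)
Lemma integral_std_normal_sym (R : realType) (p q : R -> R) :
  measurable_fun setT p -> (forall x, 0 <= p x) ->
  (forall x, p x + p (- x) = 2 * q x) ->
  (\int[@std_normal R]_x (p x)%:E = \int[@std_normal R]_x (q x)%:E)%E.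
Proof.
move=> mp p0 pq.
have mEp : measurable_fun setT (fun x => (p x)%:E) by exact/measurable_EFinP.
have mpN : measurable_fun setT (fun x : R => (p (- x))%:E).
  by apply/measurable_EFinP; exact: measurableT_comp.
have h0 : (0 <= 2^-1%:E :> \bar R)%E by rewrite lee_fin.
transitivity (\int[@std_normal R]_x (2^-1%:E * (p x)%:E + 2^-1%:E * (p (- x)%R)%:E))%E; last first.
  apply: eq_integral => x _.
  by rewrite -!EFinM -EFinD -mulrDr pq mulKf// pnatr_eq0.
rewrite ge0_integralD//=; last 4 first.
- by move=> x _; rewrite mule_ge0// lee_fin.
- exact: measurable_funeM.
- by move=> x _; rewrite mule_ge0// lee_fin.
- exact: measurable_funeM.
rewrite !ge0_integralZl//=; last 2 first.
- by move=> x _; rewrite lee_fin.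
- by move=> x _; rewrite lee_fin.
rewrite (integral_std_normalN mEp)//.
have half2 : 2^-1 + 2^-1 = 1 :> R by field.
by rewrite -ge0_muleDl// -EFinD half2 mul1e.
Qed.

(** * Moments of the standard Gaussian vector, by induction on the dimension *)

Section gaussian_moments.
Context {R : realType}.

Definition sumsq n (t : n.-tuple R) : R := \sum_(i < n) tnth t i ^+ 2.

Definition dotp n (g : 'I_n -> R) (t : n.-tuple R) : R :=
  \sum_(i < n) g i * tnth t i.

Lemma sumsq_ge0 n (t : n.-tuple R) : 0 <= sumsq t.
Proof. by apply: sumr_ge0 => i _; exact: sqr_ge0. Qed.

Lemma measurable_sumsq n : measurable_fun [set: n.-tuple R] (@sumsq n).
Proof.
have := @measurable_sum_tnth _ _ R n (fun=> fun x : R => x ^+ 2); apply=> i.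
exact: measurable_funX.
Qed.

Lemma measurable_dotp n (g : 'I_n -> R) : measurable_fun [set: n.-tuple R] (dotp g).
Proof.
have := @measurable_sum_tnth _ _ R n (fun i => fun x : R => g i * x); apply=> i.
exact: measurable_funM.
Qed.

Lemma sumsq_cons n (p : R * n.-tuple R) :
  sumsq (cons_pair p) = p.1 ^+ 2 + sumsq p.2.
Proof. exact: (@sum_tnth_cons _ _ R n (fun=> fun x : R => x ^+ 2)). Qed.

Lemma dotp_cons n (g : 'I_n.+1 -> R) (p : R * n.-tuple R) :
  dotp g (cons_pair p) = g ord0 * p.1 + dotp (g \o lift ord0) p.2.
Proof. exact: (@sum_tnth_cons _ _ R n (fun i => fun x : R => g i * x)). Qed.

(** The common inductive step: [q] bounds the integral over the first coordinate when the remaining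
    ones are frozen. *)
Lemma integral_std_gaussianS_le n (h : n.+1.-tuple R -> R) (q : n.-tuple R -> R)
    (b : R) :
  measurable_fun setT h -> (forall t, 0 <= h t) ->
  (forall t, \int[@std_normal R]_x (h (cons_pair (x, t)))%:E <= (q t)%:E)%E ->
  (\int[std_gaussian R n]_t (q t)%:E <= b%:E)%E ->
  (\int[std_gaussian R n.+1]_t (h t)%:E <= b%:E)%E.
Proof.
move=> mh h0 hq qb.
rewrite /std_gaussian ge0_integral_iidS2; last 2 first.
- exact/measurable_EFinP.
- by move=> t; rewrite lee_fin.
apply: le_trans qb; apply: le_nonmeasurable_integralT => // t.
by apply: integral_ge0 => x _; rewrite lee_fin.
Qed.

Lemma std_gaussian_sumsq_le n :
  (\int[std_gaussian R n]_t (sumsq t)%:E <= n%:R%:E)%E.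
Proof.
elim: n => [|n IH].
  rewrite /std_gaussian ge0_integral_iid0; last by apply/measurable_EFinP; exact: measurable_sumsq.
  by rewrite /sumsq big_ord0.
apply: (@integral_std_gaussianS_le _ _ (fun t => sumsq t + 1)).
- exact: measurable_sumsq.
- exact: sumsq_ge0.
- move=> t; under eq_integral do rewrite sumsq_cons/=.
  apply: (integral_std_normal_even6_le (sumsq_ge0 t) ler01 (lexx 0) (lexx 0)).
    by move=> x; ring.
  lra.
- rewrite -natr1; under eq_integral do rewrite EFinD.
  rewrite ge0_integralD//=; last 2 first.
  + by move=> x _; rewrite lee_fin sumsq_ge0.
  + by apply/measurable_EFinP; exact: measurable_sumsq.
  by rewrite integral_cst//= [std_gaussian _ _ _]probability_setT mule1 EFinD leeD2r.
Qed.

Let affine_le n (f1 f2 f3 q : n.-tuple R -> R) c0 c1 c2 c3 a1 a2 a3 b :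
  measurable_fun setT f1 -> measurable_fun setT f2 -> measurable_fun setT f3 ->
  (forall x, 0 <= f1 x) -> (forall x, 0 <= f2 x) -> (forall x, 0 <= f3 x) ->
  0 <= c0 -> 0 <= c1 -> 0 <= c2 -> 0 <= c3 ->
  (\int[std_gaussian R n]_x (f1 x)%:E <= a1%:E)%E ->
  (\int[std_gaussian R n]_x (f2 x)%:E <= a2%:E)%E ->
  (\int[std_gaussian R n]_x (f3 x)%:E <= a3%:E)%E ->
  (forall x, q x = c0 + c1 * f1 x + c2 * f2 x + c3 * f3 x) ->
  c0 + c1 * a1 + c2 * a2 + c3 * a3 <= b ->
  (\int[std_gaussian R n]_x (q x)%:E <= b%:E)%E.
Proof.
move=> m1 m2 m3 f10 f20 f30 ? ? ? ? i1 i2 i3 qE le_b.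
under eq_integral do rewrite qE.
apply: le_trans (ge0_integral_affine_le m1 m2 m3 f10 f20 f30 _ _ _ _ i1 i2 i3) _ => //.
Qed.

(** With [N] the squared norm of the tail, integrating [(x^2 + N)^2] over [x] gives [N^2 + 2 N + 3],
    and [n (n+2) + 2 n + 3 = (n+1) (n+3)]. *)
Lemma std_gaussian_sumsq2_le n :
  (\int[std_gaussian R n]_t (sumsq t ^+ 2)%:E <= (n%:R * (n%:R + 2))%:E)%E.
Proof.
have mX k j : measurable_fun setT (fun t : k.-tuple R => sumsq t ^+ j).
  by apply: measurable_funX; exact: measurable_sumsq.
have X0 k j (t : k.-tuple R) : 0 <= sumsq t ^+ j by rewrite exprn_ge0 ?sumsq_ge0.
elim: n => [|n IH].
  rewrite /std_gaussian ge0_integral_iid0; last by apply/measurable_EFinP; exact: mX.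
  by rewrite /sumsq big_ord0 expr0n mul0r.
apply: (@integral_std_gaussianS_le _ _ (fun t => sumsq t ^+ 2 + 2 * sumsq t + 3)) => //.
- move=> t; under eq_integral do rewrite sumsq_cons/=.
  have t0 := sumsq_ge0 t.
  apply: (@integral_std_normal_even6_le _ _ (sumsq t ^+ 2) (2 * sumsq t) 1 0) => //.
  + by rewrite mulr_ge0.
  + by move=> x; ring.
  + lra.
- apply: (affine_le (mX n 2) (@measurable_sumsq n) (@measurable_sumsq n)
    (X0 n 2) (@sumsq_ge0 n) (@sumsq_ge0 n) _ _ _ _ IH
    (std_gaussian_sumsq_le n) (std_gaussian_sumsq_le n)
    (c0 := 3) (c1 := 1) (c2 := 2) (c3 := 0)) => //.
  + by move=> t; ring.
  + by rewrite -natr1; lra.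
Qed.

(** Here [(x^2 + N)^3] yields [N^3 + 3 N^2 + 9 N + 15], and [n (n+2) (n+4) + 3 n (n+2) + 9 n + 15 =
    (n+1) (n+3) (n+5)]. *)
Lemma std_gaussian_sumsq3_le n :
  (\int[std_gaussian R n]_t (sumsq t ^+ 3)%:E
    <= (n%:R * (n%:R + 2) * (n%:R + 4))%:E)%E.
Proof.
have mX k j : measurable_fun setT (fun t : k.-tuple R => sumsq t ^+ j).
  by apply: measurable_funX; exact: measurable_sumsq.
have X0 k j (t : k.-tuple R) : 0 <= sumsq t ^+ j by rewrite exprn_ge0 ?sumsq_ge0.
elim: n => [|n IH].
  rewrite /std_gaussian ge0_integral_iid0; last by apply/measurable_EFinP; exact: mX.
  by rewrite /sumsq big_ord0 expr0n !mul0r.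
apply: (@integral_std_gaussianS_le _ _
  (fun t => sumsq t ^+ 3 + 3 * sumsq t ^+ 2 + 9 * sumsq t + 15)) => //.
- move=> t; under eq_integral do rewrite sumsq_cons/=.
  have t0 := sumsq_ge0 t.
  apply: (@integral_std_normal_even6_le _ _ (sumsq t ^+ 3) (3 * sumsq t ^+ 2)
    (3 * sumsq t) 1) => //.
  + by rewrite mulr_ge0.
  + by rewrite mulr_ge0.
  + by move=> x; ring.
  + lra.
- apply: (affine_le (mX n 3) (mX n 2) (@measurable_sumsq n)
    (X0 n 3) (X0 n 2) (@sumsq_ge0 n) _ _ _ _ IH
    (std_gaussian_sumsq2_le n) (std_gaussian_sumsq_le n)
    (c0 := 15) (c1 := 1) (c2 := 3) (c3 := 9)) => //.
  + by move=> t; ring.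
  + by rewrite -natr1; lra.
Qed.

Lemma std_gaussian_dotp2_le n (g : 'I_n -> R) :
  (\int[std_gaussian R n]_t (dotp g t ^+ 2)%:E
    <= (\sum_(i < n) g i ^+ 2)%:E)%E.
Proof.
have mL k (a : 'I_k -> R) : measurable_fun setT (fun t => dotp a t ^+ 2).
  by apply: measurable_funX; exact: measurable_dotp.
elim: n g => [|n IH] g.
  rewrite /std_gaussian ge0_integral_iid0; last by apply/measurable_EFinP; exact: mL.
  by rewrite /dotp !big_ord0 expr0n.
set g' := g \o lift ord0.
apply: (@integral_std_gaussianS_le _ _ (fun t => dotp g' t ^+ 2 + g ord0 ^+ 2)).
- exact: mL.
- by move=> t; exact: sqr_ge0.
- move=> t; under eq_integral do rewrite dotp_cons/= -/g'.
  (* The cross term of the square is odd in [x], so the even part keeps only the two squares. *)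
  rewrite (@integral_std_normal_sym _ _
    (fun x => dotp g' t ^+ 2 + g ord0 ^+ 2 * x ^+ 2)).
  + apply: (@integral_std_normal_even6_le _ _ (dotp g' t ^+ 2) (g ord0 ^+ 2) 0 0) => //.
    * by rewrite sqr_ge0.
    * by rewrite sqr_ge0.
    * by move=> x; ring.
    * lra.
  + by apply: measurable_funX; apply: measurable_funD => //; exact: measurable_funM.
  + by move=> x; exact: sqr_ge0.
  + by move=> x; ring.
- apply: (affine_le (mL n g') (mL n g') (mL n g') _ _ _ _ _ _ _ (IH g') (IH g') (IH g')
    (c0 := g ord0 ^+ 2) (c1 := 1) (c2 := 0) (c3 := 0)) => //;
    try by move=> *; rewrite sqr_ge0.
  + by move=> t; ring.
  + by rewrite big_ord_recl /g'/=; lra.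
Qed.

(** Let [L] and [N] be the linear form and squared norm of the tail, and [a] the first coefficient.
    After symmetrization the integral over [x] is [L^2 N + L^2 + a^2 N + 3 a^2]. If [G] is the sum
    of the other squared coefficients, the total is [(n+2) G + G + n a^2 + 3 a^2 = (n+3) (G +
    a^2)]. *)
Lemma std_gaussian_dotp2_sumsq_le n (g : 'I_n -> R) :
  (\int[std_gaussian R n]_t (dotp g t ^+ 2 * sumsq t)%:E
    <= ((n%:R + 2) * \sum_(i < n) g i ^+ 2)%:E)%E.
Proof.
have mL k (a : 'I_k -> R) : measurable_fun setT (fun t => dotp a t ^+ 2).
  by apply: measurable_funX; exact: measurable_dotp.
have mLN k (a : 'I_k -> R) : measurable_fun setT (fun t => dotp a t ^+ 2 * sumsq t).
  by apply: measurable_funM; [exact: mL|exact: measurable_sumsq].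
have LN0 k (a : 'I_k -> R) t : 0 <= dotp a t ^+ 2 * sumsq t.
  by rewrite mulr_ge0 ?sqr_ge0 ?sumsq_ge0.
elim: n g => [|n IH] g.
  rewrite /std_gaussian ge0_integral_iid0; last by apply/measurable_EFinP; exact: mLN.
  by rewrite /dotp /sumsq !big_ord0 !mulr0.
set g' := g \o lift ord0; have g00 := sqr_ge0 (g ord0).
apply: (@integral_std_gaussianS_le _ _ (fun t => dotp g' t ^+ 2 * sumsq t
  + dotp g' t ^+ 2 + g ord0 ^+ 2 * sumsq t + 3 * g ord0 ^+ 2)) => //.
- move=> t; under eq_integral do rewrite dotp_cons sumsq_cons/= -/g'.
  have t0 := sumsq_ge0 t; have L0 := sqr_ge0 (dotp g' t).
  rewrite (@integral_std_normal_sym _ _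
    (fun x => (dotp g' t ^+ 2 + g ord0 ^+ 2 * x ^+ 2) * (x ^+ 2 + sumsq t))).
  + apply: (@integral_std_normal_even6_le _ _ (dotp g' t ^+ 2 * sumsq t)
      (g ord0 ^+ 2 * sumsq t + dotp g' t ^+ 2) (g ord0 ^+ 2) 0) => //.
    * by apply: addr_ge0; [exact: mulr_ge0|exact: L0].
    * by move=> x; ring.
    * lra.
  + apply: measurable_funM; last by apply: measurable_funD => //; exact: measurable_funX.
    by apply: measurable_funX; apply: measurable_funD => //; exact: measurable_funM.
  + by move=> x; rewrite mulr_ge0 ?addr_ge0 ?sqr_ge0.
  + by move=> x; ring.
- apply: (affine_le (mLN n g') (mL n g') (@measurable_sumsq n) (LN0 n g') _
    (@sumsq_ge0 n) _ _ _ _ (IH g') (std_gaussian_dotp2_le g') (std_gaussian_sumsq_le n)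
    (c0 := 3 * g ord0 ^+ 2) (c1 := 1) (c2 := 1) (c3 := g ord0 ^+ 2)) => //.
  + by move=> t; rewrite sqr_ge0.
  + by rewrite mulr_ge0.
  + by move=> t; ring.
  + rewrite big_ord_recl /g'/= -natr1; lra.
Qed.

End gaussian_moments.

(** * Cauchy-Schwarz and the quadratic Taylor bound for smooth functions *)

Section smooth_functions.
Context {R : realType} {d : nat}.
Implicit Types (x v a b : 'rV[R]_d) (F : 'rV[R]_d -> R).

Definition rdot a b : R := \sum_(i < d) a 0 i * b 0 i.

Lemma enorm_sqr x : enorm x ^+ 2 = \sum_(i < d) x 0 i ^+ 2.
Proof. by rewrite sqr_sqrtr//; apply: sumr_ge0 => i _; exact: sqr_ge0. Qed.

Lemma enormZ (t : R) v : enorm (t *: v) = `|t| * enorm v.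
Proof.
rewrite /enorm -sqrtr_sqr -sqrtrM ?sqr_ge0// mulr_sumr.
by congr Num.sqrt; apply: eq_bigr => i _; rewrite mxE exprMn.
Qed.

Lemma rdotBl a b v : rdot (a - b) v = rdot a v - rdot b v.
Proof.
rewrite /rdot -sumrB; apply: eq_bigr => i _; rewrite !mxE; ring.
Qed.

(* The sum of the squares of [B a_i - C b_i], where [B = |b|^2] and
   [C = a . b], equals [B (|a|^2 B - C^2)]. *)
Lemma normr_rdot_le a b : `|rdot a b| <= enorm a * enorm b.
Proof.
rewrite -sqrtr_sqr /enorm -sqrtrM; last by apply: sumr_ge0 => i _; exact: sqr_ge0.
rewrite ler_wsqrtr//.
have expand (s t : R) : \sum_(i < d) (s * a 0 i - t * b 0 i) ^+ 2 =
    s ^+ 2 * (\sum_(i < d) a 0 i ^+ 2) + - (2 * s * t) * rdot a b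
    + t ^+ 2 * (\sum_(i < d) b 0 i ^+ 2).
  rewrite /rdot !mulr_sumr -!big_split/=.
  by apply: eq_bigr => i _; ring.
set A := (\sum_(i < d) a 0 i ^+ 2); set B := (\sum_(i < d) b 0 i ^+ 2).
have B0 : 0 <= B by apply: sumr_ge0 => i _; exact: sqr_ge0.
set C := rdot a b.
have : 0 <= \sum_(i < d) (B * a 0 i - C * b 0 i) ^+ 2.
  by apply: sumr_ge0 => i _; exact: sqr_ge0.
rewrite expand -/A -/B -/C.
have -> : B ^+ 2 * A + - (2 * B * C) * C + C ^+ 2 * B = B * (A * B - C ^+ 2) by ring.
move: B0; rewrite le_eqVlt => /predU1P[B0 _|B0]; last first.
  by rewrite pmulr_rge0// subr_ge0.
(* Only [B = 0] remains, where one cannot divide by [B]: every [b_i] vanishes, hence so does [C]. *)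
have b0 i : b 0 i = 0.
  apply/eqP; rewrite -sqrf_eq0; move: (esym B0) => /eqP.
  rewrite psumr_eq0; last by move=> j _; exact: sqr_ge0.
  by move=> /allP /(_ i); rewrite mem_index_enum => /(_ isT).
rewrite /C /rdot big1 ?expr0n/= -?B0 ?mulr0// => i _.
by rewrite b0 mulr0.
Qed.

(** The difference quotient of the restriction to the line is that of [F] in direction [v];
    linearity of the differential then expands [v] in the standard basis. *)
Lemma is_derive_line F x v (t : R) : differentiable F (x + t *: v) ->
  is_derive t 1 (fun s : R => F (x + s *: v)) (rdot (gradient F (x + t *: v)) v).
Proof.
move=> dF.
have E : (fun h : R => h^-1 *: (((fun s : R => F (x + s *: v)) \o shift t) (h *: 1)
      - F (x + t *: v))) =
    (fun h : R => h^-1 *: ((F \o shift (x + t *: v)) (h *: v) - F (x + t *: v))).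
  apply/funext => h /=; congr (_ *: (F _ - _)).
  by rewrite [h *: 1]mulr1 scalerDl addrCA.
apply: DeriveDef; first by rewrite /derivable E; exact: diff_derivable.
transitivity ('D_v F (x + t *: v)); first by rewrite /derive E.
move: (x + t *: v) dF {E} => y dF.
rewrite deriveE// [in LHS](row_sum_delta v) linear_sum; apply: eq_bigr => i _.
by rewrite linearZ mxE deriveE// mulrC.
Qed.

(** The mean value theorem is applied to [g], whose quadratic term is chosen so that the Lipschitz
    bound on the gradient makes its derivative nonpositive on [[0, 1]]. *)
Lemma smooth_taylor H F x v : smooth H F ->
  `|F (x + v) - F x - rdot (gradient F x) v| <= H / 2 * enorm v ^+ 2.
Proof.
move=> [dF lipF].
set z := F (x + v) - F x - rdot (gradient F x) v.
(* Multiplying by the sign of the remainder turns [z] into its absolute value, so one function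
   handles both signs. *)
pose e := Num.sg z.
have e1 : `|e| <= 1 by rewrite normr_sg; case: (z != 0).
pose g (t : R) : R := e * (F (x + t *: v) - t * rdot (gradient F x) v)
  - H / 2 * enorm v ^+ 2 * t ^+ 2.
pose g' (t : R) : R := e * (rdot (gradient F (x + t *: v)) v - rdot (gradient F x) v)
  - H / 2 * enorm v ^+ 2 * (2 * t).
have dg (t : R) : is_derive t 1 g (g' t).
  have dl := is_derive_line (dF (x + t *: v)).
  have d2 : is_derive t 1 (fun s : R => s ^+ 2) (2 * t).
    apply: DeriveDef; first exact: exprn_derivable.
    by rewrite exp_derive /GRing.scale/= expr1 mulr1.
  rewrite /g /g'; apply: is_derive_eq.
  move: (rdot _ v) (rdot _ v) => p q.
  by rewrite /GRing.scale/=; ring.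
have cg : {within `[0, 1], continuous g}.
  by apply: derivable_within_continuous => t _; exact: ex_derive.
have [c /[!in_itv]/= /andP[c0 _]] := MVT ltr01 (fun t _ => dg t) cg.
have z_abs : e * z = `|z| by rewrite /e -normrEsg.
have -> : g 1 - g 0 = `|z| - H / 2 * enorm v ^+ 2.
  by rewrite -z_abs /g /z scale1r scale0r addr0; ring.
rewrite subr0 mulr1 => zE; rewrite -subr_le0 zE /g' subr_le0 -rdotBl.
apply: (le_trans (ler_norm _)); rewrite normrM.
apply: (le_trans (ler_piMl _ e1)) => //.
apply: (le_trans (normr_rdot_le _ _)).
have := lipF (x + c *: v) x.
rewrite addrAC subrr add0r enormZ gtr0_norm// => /(ler_wpM2r (sqrtr_ge0 _)) h.
apply: (le_trans (h _)); rewrite le_eqVlt; apply/orP; left; apply/eqP.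
by rewrite /enorm; field.
Qed.

End smooth_functions.

(** On a probability space [1 + h^2] is integrable, and it dominates [|h|]. *)
Lemma integrable_of_sqr d (T : measurableType d) (R : realType)
    (P : probability T R) (h : T -> R) (v : R) :
  measurable_fun setT h -> (\int[P]_x (h x ^+ 2)%:E <= v%:E)%E ->
  P.-integrable setT (fun x => (h x)%:E).
Proof.
move=> mh hv.
have ih2 := integrable_sqr mh hv.
have i1 : P.-integrable setT (fun=> 1%:E) by exact: finite_measure_integrable_cst.
apply: le_integrable (integrableD measurableT i1 ih2) => //.
  by apply/measurable_EFinP.
move=> x _; change ((`|h x|)%:E <= (`|1 + h x ^+ 2|)%:E)%E; rewrite lee_fin.
have h0 := sqr_ge0 (h x); rewrite [leRHS]ger0_norm ?addr_ge0//.
by rewrite ler_norml; apply/andP; split; nra.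
Qed.

(** * Second moment of the estimator for a fixed direction *)

Section estimator_bound.
Context {R : realType} {d k : nat}.
Variables (D : 'rV[R]_d -> probability (k.-tuple R) R).
Variables (f : 'rV[R]_d -> k.-tuple R -> R) (sigma : R).
Hypothesis mf : forall x, measurable_fun [set: k.-tuple R] (f x).
Hypothesis var : bounded_variance D f sigma.
Let F := objective D f.

Lemma centered_second_moment y :
  (\int[D y]_xi ((f y xi - F y) ^+ 2)%:E <= (sigma ^+ 2)%:E)%E.
Proof.
have := var y; rewrite unlock; apply: le_trans.
rewrite le_eqVlt; apply/orP; left; apply/eqP; apply: eq_integral => xi _.
by rewrite -sqrrN opprB.
Qed.

Lemma measurable_centered y : measurable_fun setT (fun xi => f y xi - F y).
Proof. by apply: measurable_funB. Qed.

Lemma integrable_centered y : (D y).-integrable setT (fun xi => (f y xi - F y)%:E).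
Proof.
exact: integrable_of_sqr (measurable_centered y) (centered_second_moment y).
Qed.

(** [F y] is defined through [fine], so it is the true mean only once [f y] is known to be
    integrable. This follows from the variance bound, which controls [f y - F y] for [F y] taken
    merely as a real number. *)
Lemma integral_centered y : (\int[D y]_xi (f y xi - F y)%:E = 0)%E.
Proof.
have iF : (D y).-integrable setT (fun=> (F y)%:E) by exact: finite_measure_integrable_cst.
have fE : (fun xi => (f y xi)%:E) = (fun xi => (f y xi - F y)%:E + (F y)%:E)%E.
  by apply/funext => xi; rewrite -EFinD subrK.
have intf : (D y).-integrable setT (fun xi => (f y xi)%:E).
  by rewrite fE; apply: integrableD => //; exact: integrable_centered.
have EF : (\int[D y]_xi (f y xi)%:E = (F y)%:E)%E.
  by rewrite /F /objective unlock fineK//; exact: integrable_fin_num.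
under eq_integral do rewrite EFinB.
rewrite integralB//= EF integral_cst//= [D y _]probability_setT mule1.
by rewrite -EFinB subrr.
Qed.

Lemma enorm_row_of_tuple (u : d.-tuple R) :
  enorm (row_of_tuple u) ^+ 2 = sumsq u.
Proof. by rewrite enorm_sqr; apply: eq_bigr => i _; rewrite mxE. Qed.

Lemma rdot_row_of_tuple (a : 'rV[R]_d) (u : d.-tuple R) :
  rdot a (row_of_tuple u) = dotp (a 0) u.
Proof. by apply: eq_bigr => i _; rewrite mxE. Qed.

(** All [m] terms share the direction [u], so the squared norm is [K] times the square of [S], a
    centered sum shifted by [m (F y - c)]. The second moment of [S] is at most
    [m sigma^2 + m^2 (F y - c)^2]. *)
Lemma expectation_estimator_le (x : 'rV[R]_d) (c mu : R) (u : d.-tuple R) (m : nat) :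
  (0 < m)%N -> 0 < mu ->
  ('E_(iid_prob (D (x + mu *: row_of_tuple u)) m)
     [fun xi : m.-tuple (k.-tuple R) =>
        (enorm (m%:R^-1 *: \sum_(j < m)
          one_point_estimator f x mu c (row_of_tuple u) (tnth xi j)) ^+ 2)%R]
   <= (sumsq u / mu ^+ 2 *
       (sigma ^+ 2 / m%:R + (F (x + mu *: row_of_tuple u) - c) ^+ 2))%:E)%E.
Proof.
move=> m_gt0 mu_gt0; rewrite unlock; set y := x + _.
have m0 : m%:R != 0 :> R by rewrite pnatr_eq0 -lt0n.
have mu0 : mu != 0 by rewrite gt_eqF.
pose K := sumsq u / (m%:R * mu) ^+ 2.
have K0 : 0 <= K by rewrite divr_ge0 ?sumsq_ge0 ?sqr_ge0.
pose S (xi : m.-tuple (k.-tuple R)) : R :=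
  \sum_(j < m) (f y (tnth xi j) - F y) + m%:R * (F y - c).
have E xi : (enorm (m%:R^-1 *: \sum_(j < m)
    one_point_estimator f x mu c (row_of_tuple u) (tnth xi j)) ^+ 2) = K * S xi ^+ 2.
  rewrite -scaler_suml scalerA enormZ exprMn real_normK ?num_real//.
  rewrite enorm_row_of_tuple /K -mulr_suml.
  have -> : \sum_(j < m) (f (x + mu *: row_of_tuple u) (tnth xi j) - c) = S xi.
    have mE : m%:R * (F y - c) = \sum_(j < m) (F y - c).
      by rewrite sumr_const card_ord mulr_natl.
    rewrite /S mE -big_split/=.
    by apply: eq_bigr => j _; rewrite -/y; ring.
  by field; rewrite mu0 m0.
under eq_integral do rewrite E EFinM.
have mS : measurable_fun setT (fun xi => (S xi ^+ 2)%:E).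
  apply/measurable_EFinP; apply: measurable_funX; apply: measurable_funD => //.
  have := @measurable_sum_tnth _ _ R m (fun=> fun xi => f y xi - F y).
  by apply=> _; exact: measurable_centered.
rewrite ge0_integralZl//; last by move=> xi _; rewrite lee_fin sqr_ge0.
apply: le_trans.
  apply: lee_wpmul2l; first by rewrite lee_fin.
  exact: (iid_integral_sqr_sumD_le (measurable_centered y) (integrable_centered y)
    (integral_centered y) (centered_second_moment y)).
rewrite -EFinM lee_fin le_eqVlt; apply/orP; left; apply/eqP.
by rewrite /K; field; rewrite mu0 m0.
Qed.

Lemma objective_deviation_le (H : R) (x : 'rV[R]_d) (c mu : R) (u : d.-tuple R) :
  smooth H F ->
  (F (x + mu *: row_of_tuple u) - c) ^+ 2 <=
  3 * ((H ^+ 2 / 4 * mu ^+ 4) * sumsq u ^+ 2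
       + mu ^+ 2 * dotp (gradient F x 0) u ^+ 2 + (F x - c) ^+ 2).
Proof.
move=> smF; have := smooth_taylor x (mu *: row_of_tuple u) smF.
rewrite enormZ exprMn real_normK ?num_real// enorm_row_of_tuple.
have -> : rdot (gradient F x) (mu *: row_of_tuple u) = mu * dotp (gradient F x 0) u.
  rewrite -rdot_row_of_tuple /rdot mulr_sumr; apply: eq_bigr => i _.
  by rewrite !mxE mulrCA.
set L := dotp _ _; set N := sumsq u; set z := (X in `|X|) => z_le.
have -> : F (x + mu *: row_of_tuple u) - c = z + mu * L + (F x - c).
  by rewrite /z; ring.
(* The bound on [|z|] is nonnegative since it dominates an absolute value, so the inequality may be
   squared. *)
have z2 : z ^+ 2 <= H ^+ 2 / 4 * mu ^+ 4 * N ^+ 2.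
  have -> : H ^+ 2 / 4 * mu ^+ 4 * N ^+ 2 = (H / 2 * (mu ^+ 2 * N)) ^+ 2 by field.
  by rewrite -real_normK ?num_real// lerXn2r// nnegrE (le_trans _ z_le).
(* The defect in [(a + b + c)^2 <= 3 (a^2 + b^2 + c^2)] is the sum of the squared pairwise
   differences. *)
have : 3 * (z ^+ 2 + (mu * L) ^+ 2 + (F x - c) ^+ 2) -
    (z + mu * L + (F x - c)) ^+ 2 = (z - mu * L) ^+ 2
    + (mu * L - (F x - c)) ^+ 2 + (z - (F x - c)) ^+ 2 by ring.
have := sqr_ge0 (z - mu * L); have := sqr_ge0 (mu * L - (F x - c)).
have := sqr_ge0 (z - (F x - c)); rewrite [(mu * L) ^+ 2]exprMn; lra.
Qed.

End estimator_bound.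

Theorem lemma3 (R : realType) (d k : nat)
    (D : 'rV[R]_d -> probability (k.-tuple R) R)
    (f : 'rV[R]_d -> k.-tuple R -> R)
    (f_meas : forall x, measurable_fun [set: k.-tuple R] (f x))
    (sigma : R) (sigma_ge0 : 0 <= sigma)
    (assumption1 : bounded_variance D f sigma)
    (H : R) (assumption4 : smooth H (objective D f))
    (x : 'rV[R]_d) (c mu : R) (mu_gt0 : 0 < mu) (m : nat) (m_ge1 : (1 <= m)%N) :
  (\int[std_gaussian R d]_u
     'E_(iid_prob (D (x + mu *: row_of_tuple u)%R) m)
       [fun xi : m.-tuple (k.-tuple R) =>
          (enorm (m%:R^-1 *: \sum_(j < m)
            one_point_estimator f x mu c (row_of_tuple u) (tnth xi j)) ^+ 2)%R]
   <= (3 / 2 * mu ^+ 2 * H ^+ 2 * (d%:R + 6) ^+ 3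
       + 6 * (d%:R + 4) * enorm (gradient (objective D f) x) ^+ 2
       + 3 * sigma ^+ 2 * d%:R / (mu ^+ 2 * m%:R)
       + 3 * d%:R * (objective D f x - c) ^+ 2 / mu ^+ 2)%:E)%E.
Proof.
set F := objective D f.
set g := gradient F x.
(* [c1] and [c3] are the coefficients of [|u|^2] and [|u|^6] once [|u|^2 / mu^2] is distributed over
   the deviation bound; the mixed term gets coefficient 3. *)
pose c1 := mu ^- 2 * (sigma ^+ 2 / m%:R + 3 * (F x - c) ^+ 2).
pose c3 := 3 / 4 * H ^+ 2 * mu ^+ 2.
have mu0 : mu != 0 by rewrite gt_eqF.
have mu2 : 0 < mu ^+ 2 by rewrite exprn_gt0.
have m0 : 0 < m%:R :> R by rewrite ltr0n.
have s0 : 0 <= sigma ^+ 2 / m%:R by rewrite divr_ge0 ?sqr_ge0// ltW.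
have d0 : 0 <= d%:R :> R by [].
have g0 : 0 <= enorm g ^+ 2 by exact: sqr_ge0.
have c10 : 0 <= c1.
  apply: mulr_ge0; first by rewrite invr_ge0 ltW.
  by apply: addr_ge0 => //; apply: mulr_ge0 => //; exact: sqr_ge0.
have c30 : 0 <= c3.
  by do 2 ?[apply: mulr_ge0; last exact: sqr_ge0]; rewrite divr_ge0.
apply: (@le_trans _ _ (\int[std_gaussian R d]_u
    (0 + c1 * sumsq u + 3 * (dotp (g 0) u ^+ 2 * sumsq u) + c3 * sumsq u ^+ 3)%:E)%E).
  apply: le_nonmeasurable_integralT => u.
    by apply: expectation_ge0 => xi; exact: sqr_ge0.
  apply: (le_trans (expectation_estimator_le f_meas assumption1 x c u m_ge1 mu_gt0)).
  have N0 := sumsq_ge0 u.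
  rewrite lee_fin; apply: (@le_trans _ _ (sumsq u / mu ^+ 2 * (sigma ^+ 2 / m%:R +
    3 * ((H ^+ 2 / 4 * mu ^+ 4) * sumsq u ^+ 2
       + mu ^+ 2 * dotp (g 0) u ^+ 2 + (F x - c) ^+ 2)))).
    apply: ler_wpM2l; first by rewrite divr_ge0// ltW.
    by rewrite lerD2l; exact: objective_deviation_le.
  rewrite le_eqVlt; apply/orP; left; apply/eqP; rewrite /c1 /c3; field.
  by rewrite mu0 gt_eqF.
have h3 : 0 <= 3 :> R by [].
apply: le_trans.
  apply: (ge0_integral_affine_le _ _ _ _ _ _ (lexx 0) c10 h3 c30
    (std_gaussian_sumsq_le d) (std_gaussian_dotp2_sumsq_le (g 0))
    (std_gaussian_sumsq3_le d)) => //.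
  - exact: measurable_sumsq.
  - apply: measurable_funM; last exact: measurable_sumsq.
    by apply: measurable_funX; exact: measurable_dotp.
  - by apply: measurable_funX; exact: measurable_sumsq.
  - exact: sumsq_ge0.
  - by move=> u; rewrite mulr_ge0 ?sqr_ge0 ?sumsq_ge0.
  - by move=> u; rewrite exprn_ge0 ?sumsq_ge0.
rewrite lee_fin -enorm_sqr add0r addrC.
have -> : 3 * sigma ^+ 2 * d%:R / (mu ^+ 2 * m%:R) =
    3 * (mu ^- 2 * (sigma ^+ 2 / m%:R)) * d%:R by field; rewrite mu0 gt_eqF.
have -> : 3 * d%:R * (F x - c) ^+ 2 / mu ^+ 2 = mu ^- 2 * (3 * (F x - c) ^+ 2) * d%:R by field.
(* Since [3/2 = 2 * 3/4], this amounts to [d (d+2) (d+4) <= 2 (d+6)^3], far from tight. *)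
have t1 : c3 * (d%:R * (d%:R + 2) * (d%:R + 4)) <= 3 / 2 * mu ^+ 2 * H ^+ 2 * (d%:R + 6) ^+ 3.
  have -> : 3 / 2 * mu ^+ 2 * H ^+ 2 * (d%:R + 6) ^+ 3 = c3 * (2 * (d%:R + 6) ^+ 3).
    by rewrite /c3; field.
  apply: ler_wpM2l => //; move: (d%:R) d0 => e e0; nra.
have t2 : 3 * ((d%:R + 2) * enorm g ^+ 2) <= 6 * (d%:R + 4) * enorm g ^+ 2 by nra.
(* The variance term carries factor 1 in [c1] but 3 in the claim; the two spare copies are
   nonnegative. *)
have t3 : c1 * d%:R <= 3 * (mu ^- 2 * (sigma ^+ 2 / m%:R)) * d%:R
    + mu ^- 2 * (3 * (F x - c) ^+ 2) * d%:R.
  have : 0 <= mu ^- 2 * (sigma ^+ 2 / m%:R) * d%:R by rewrite !mulr_ge0// invr_ge0 ltW.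
  by rewrite /c1; lra.
lra.
Qed.
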